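(* Let $h\in(0,1)$, $q\in(0,n/h)$ and define $q^*_h:=nq/(n-hq)$. If $f\in W^{h,q}(\mathbb{R}^n)$, then $$\left(\int_{\mathbb{R}^n}|f|^{q^*_h}\,dx\right)^{1/q^*_h}\le c\left(\int_{\mathbb{R}^n}\int_{\mathbb{R}^n}\frac{|f(x)-f(y)|^q}{|x-y|^{n+hq}}\,dx\,dy\right)^{1/q}$$ for a constant $c=c(n,h,q)>0$. In particular, if $f\in W^{h,q}(\mathbb{R}^n)$ satisfies $f=0$ a.e. in $\mathbb{R}^n\setminus B_r$ for a ball $B_r$ of radius $r>0$, then $$\left(\frac{1}{|B_r|}\int_{B_r}|f|^{q^*_h}\,dx\right)^{1/q^*_h}\le\frac{c\,r^h}{(t-1)^{1/q}}\left(\frac{1}{|B_{tr}|}\int_{B_{tr}}\int_{B_{tr}}\frac{|f(x)-f(y)|^q}{|x-y|^{n+hq}}\,dx\,dy\right)^{1/q}$$ for any $t\in(1,2]$, where $c=c(n,h,q)>0$ and $B_{tr}$ is the ball of radius $tr$ concentric with $B_r$.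
   Context: $n\ge2$. For $U\subseteq\mathbb{R}^n$ open, $h\in(0,1)$ and $q\in(0,\infty)$ (values $q<1$ allowed), $W^{h,q}(U)$ is the set of measurable $f$ with $\int_U|f|^q\,dx+\int_U\int_U\frac{|f(x)-f(y)|^q}{|x-y|^{n+hq}}\,dx\,dy<\infty$. *)

(* Defs.v *)
From HB Require Import structures.
From mathcomp Require Import all_boot all_order all_algebra.
From mathcomp Require Import all_classical all_reals all_analysis.
Set Implicit Arguments.
Unset Strict Implicit.
Unset Printing Implicit Defensive.
Import Order.TTheory GRing.Theory Num.Theory.
Import numFieldNormedType.Exports.
Local Open Scope classical_set_scope.
Local Open Scope ring_scope.

Definition tcons (T : Type) (n : nat) (z : T * n.-tuple T) : n.+1.-tuple T :=
  [tuple of z.1 :: z.2].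

(* n-fold product of the one-dimensional Lebesgue measure, on the Borel
   (= product) sigma-algebra of n.-tuple R *)
Fixpoint borel_lebesgue (R : realType) (n : nat) : set (n.-tuple R) -> \bar R :=
  if n is m.+1
  then pushforward (@lebesgue_measure R \x @borel_lebesgue R m)%E (@tcons R m)
  else \d_ [tuple].

Lemma measurable_tcons (R : realType) (n : nat) :
  measurable_fun setT (@tcons R n).
Proof. exact: measurable_cons. Qed.

Section tcons_pushforward.
Context (R : realType) (n : nat).
Variable m : {sigma_finite_measure set (n.-tuple R) -> \bar R}.

Let mu : set (n.+1.-tuple R) -> \bar R :=
  pushforward (@lebesgue_measure R \x m)%E (@tcons R n).

Let mu0 : mu set0 = 0%E.
Proof. by rewrite /mu /pushforward preimage_set0 measure0. Qed.

Let mu_ge0 A : (0 <= mu A)%E.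
Proof. by rewrite /mu /pushforward measure_ge0. Qed.

Let mu_sigma_additive : semi_sigma_additive mu.
Proof.
move=> F mF tF mUF; rewrite /mu /pushforward preimage_bigcup.
apply: measure_semi_sigma_additive.
- move=> k; rewrite -[X in measurable X]setTI; exact: measurable_tcons.
- apply/trivIsetP => /= i j _ _ ij; rewrite -preimage_setI.
  by move/trivIsetP : tF => /(_ _ _ _ _ ij) ->//; rewrite preimage_set0.
- rewrite -preimage_bigcup -[X in measurable X]setTI; exact: measurable_tcons.
Qed.

HB.instance Definition _ := isMeasure.Build _ _ _ mu
  mu0 mu_ge0 mu_sigma_additive.

Let mu_sigma_finite : sigma_finite setT mu.
Proof.
have /sigma_finiteP[F [TF ndF Foo]] := sigma_finiteT (@lebesgue_measure R).
have /sigma_finiteP[G [TG ndG Goo]] := sigma_finiteT m.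
exists (fun k => [set t : n.+1.-tuple R |
    F k (tnth t ord0) /\ G k [tuple of behead t]]).
  apply/esym/seteqP; split=> // t _.
  have /= [i _ Fi] : (\bigcup_i F i) (tnth t ord0) by rewrite -TF.
  have /= [j _ Gj] : (\bigcup_i G i) [tuple of behead t] by rewrite -TG.
  exists (maxn i j) => //; split.
  - by move: Fi; exact/subsetPset/ndF/leq_maxl.
  - by move: Gj; exact/subsetPset/ndG/leq_maxr.
move=> k; have [mF Fk] := Foo k; have [mG Gk] := Goo k; split.
  apply: measurableI.
    by rewrite -[X in measurable X]setTI; exact: measurable_tnth.
  by rewrite -[X in measurable X]setTI; exact: measurable_behead.
rewrite /mu /pushforward.
have -> : @tcons R n @^-1` [set t |
    F k (tnth t ord0) /\ G k [tuple of behead t]] = F k `*` G k.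
  have tconsK x (t : n.-tuple R) : [tuple of behead (tcons (x, t))] = t.
    exact: val_inj.
  by apply/seteqP; split=> -[x t] /=; rewrite tconsK.
by rewrite product_measure1E// lte_mul_pinfty// ge0_fin_numE.
Qed.

HB.instance Definition _ := Measure_isSigmaFinite.Build _ _ _ mu
  mu_sigma_finite.

Lemma tcons_pushforward_sfmeasure :
  exists m' : {sigma_finite_measure set (n.+1.-tuple R) -> \bar R},
    mu = m' :> (set _ -> _).
Proof. by exists mu. Qed.

End tcons_pushforward.

Lemma borel_lebesgue_sfmeasure (R : realType) (n : nat) :
  exists m : {sigma_finite_measure set (n.-tuple R) -> \bar R},
    @borel_lebesgue R n = m :> (set _ -> _).
Proof.
elim: n => [|n [m Em]] /=; first by exists (\d_ [tuple]).
by rewrite Em; exact: tcons_pushforward_sfmeasure.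
Qed.

Section borel_lebesgue_measure.
Context (R : realType) (n : nat).

Let mu : set (n.-tuple R) -> \bar R := @borel_lebesgue R n.

Let mu0 : mu set0 = 0%E.
Proof. by rewrite /mu; have [m ->] := borel_lebesgue_sfmeasure R n. Qed.

Let mu_ge0 A : (0 <= mu A)%E.
Proof. by rewrite /mu; have [m ->] := borel_lebesgue_sfmeasure R n. Qed.

Let mu_sigma_additive : semi_sigma_additive mu.
Proof.
rewrite /mu; have [m ->] := borel_lebesgue_sfmeasure R n.
exact: measure_semi_sigma_additive.
Qed.

HB.instance Definition _ := isMeasure.Build _ _ _ (@borel_lebesgue R n)
  mu0 mu_ge0 mu_sigma_additive.

Let mu_sigma_finite : sigma_finite setT mu.
Proof.
rewrite /mu; have [m ->] := borel_lebesgue_sfmeasure R n; exact: sigma_finiteT.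
Qed.

HB.instance Definition _ := Measure_isSigmaFinite.Build _ _ _
  (@borel_lebesgue R n) mu_sigma_finite.

End borel_lebesgue_measure.

(* R^n as the type n.-tuple R carrying the sigma-algebra of Lebesgue
   measurable sets (the completion of the Borel sigma-algebra) *)
Notation Rn R n := (caratheodory_type (mu_ext (@borel_lebesgue R n))).

Definition lebesgue (R : realType) (n : nat) : set (Rn R n) -> \bar R :=
  @completed_measure_extension _ _ _ (@borel_lebesgue R n).

HB.instance Definition _ (R : realType) (n : nat) :=
  Measure.on (@lebesgue R n).

HB.instance Definition _ (R : realType) (n : nat) :=
  @Measure_isSigmaFinite.Build _ _ _ (@lebesgue R n)
    (completed_measure_extension_sigma_finite
      (sigma_finiteT (@borel_lebesgue R n))).

Definition edist (R : realType) (n : nat) (x y : Rn R n) : R :=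
  Num.sqrt (\sum_(i < n) (tnth x i - tnth y i) ^+ 2).

Definition eball (R : realType) (n : nat) (x : Rn R n) (r : R) :
  set (Rn R n) := [set y | edist x y < r].

Section fractional_sobolev.
Local Open Scope ereal_scope.
Context (R : realType) (n : nat).
Implicit Types (h q : R) (U : set (Rn R n)) (f : Rn R n -> R).

(* on the diagonal the integrand is 0 / 0 = 0 *)
Definition gagliardo h q U f : \bar R :=
  \int[@lebesgue R n]_(y in U) \int[@lebesgue R n]_(x in U)
    (`|f x - f y| `^ q / (edist x y) `^ (n%:R + h * q))%:E.

Definition fractional_sobolev h q U f : Prop :=
  measurable_fun U f /\
  \int[@lebesgue R n]_(x in U) (`|f x| `^ q)%:E + gagliardo h q U f < +oo.

End fractional_sobolev.

Definition sobolev_exponent (R : realType) (n : nat) (h q : R) : R :=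
  n%:R * q / (n%:R - h * q).

(* Main.v *)
Require Import Defs.
From mathcomp Require Import all_boot all_order all_algebra.
From mathcomp Require Import all_classical all_reals all_analysis.
From mathcomp Require Import measurable_realfun ring lra.
Set Implicit Arguments.
Unset Strict Implicit.
Unset Printing Implicit Defensive.
Import Order.TTheory GRing.Theory Num.Theory.
Import numFieldNormedType.Exports.
Local Open Scope classical_set_scope.
Local Open Scope ring_scope.

(** Write [qs = q / (1 - th)] with [th = h q / n], so that [qs] is the Sobolev
exponent, and let [u = |f|], [I = \int u ^ qs].  The inequality is pointwise
before it is integrated.  Fix [y] with [u y > 0] and put [l = u y / 2].  On the
complement of [E = {u > l}] one has [|u x - u y| >= l], and by Chebyshev's
inequality [|E| <= L := l ^ (- qs) I].  A set of measure at most [L] cannot fill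
a ball around [y] of volume [2 L], so the kernel [|x - y| ^ (- (n + h q))] keeps
on the complement of [E] a mass of order [L ^ (- th)].  Hence the inner
Gagliardo integral at [y] is at least of order
[l ^ q L ^ (- th) = l ^ (q + qs th) I ^ (- th) = l ^ qs I ^ (- th)],
because [q + qs th = qs].  Integrating in [y] gives that the double integral
dominates [I ^ (1 - th)], which is the claim since [(1 - th) / q = 1 / qs].
Only the sizes of [f] at two points are compared and no convexity of the
[q]-th power is involved, so exponents [q < 1] need no separate treatment.

Dividing by [I ^ th] requires [I] to be finite; this is why [nonlocal_sobolev]
applies the argument to the truncations [min |f| N], which have smaller
Gagliardo energy, and passes to the limit by monotone convergence.

The only property of the kernel that enters is isolated as
[isoperimetric_kernel].  It holds on the whole space
([gagliardo_kernel_isoperimetric_space]), which gives the first inequality, and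
also for [y] in a ball [B_r], sets [E] inside [B_r] up to a null set and
integration over [B_(t r)], with a constant proportional to [t - 1]
([gagliardo_kernel_isoperimetric_ball]), which gives the second one directly,
without passing through the first.  In the latter case, if the critical radius
is at most [2 r], a fixed proportion of the critical ball around [y] lies in
[B_r] and the argument above is unchanged.  Otherwise [r ^ n] is at most of
order [L], and the shell [B_(t r) \ B_r], of volume at least of order
[(t - 1) r ^ n] and almost all outside [E], carries enough mass by itself. *)

(** * A nonlocal Sobolev inequality on a measure space *)

Lemma le_poweR (R : realType) (r : R) (x y : \bar R) :
  0 <= r -> (0 <= x)%E -> (x <= y)%E -> (x `^ r <= y `^ r)%E.
Proof.
move=> r0 x0 xy; apply: gt0_ler_poweR => //; rewrite in_itv/= leey andbT//.
exact: le_trans xy.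
Qed.

Section nonlocal_sobolev.
Local Open Scope ereal_scope.
Context d (T : measurableType d) (R : realType) (mu : {measure set T -> \bar R}).

(** The integral of a nonnegative function is a supremum over simple functions
below it, hence monotone for arbitrary functions.  This dispenses with proving
that the inner integral is a measurable function of the outer variable. *)
Lemma ge0_le_integral_subset (D U : set T) (f g : T -> \bar R) :
  D `<=` U -> (forall x, D x -> 0 <= f x <= g x) -> (forall x, U x -> 0 <= g x) ->
  \int[mu]_(x in D) f x <= \int[mu]_(x in U) g x.
Proof.
move=> DU fg g0; rewrite integral_mkcond [leRHS]integral_mkcond.
have f0 x : 0 <= (f \_ D) x.
  by rewrite patchE; case: ifPn => // /set_mem /fg/andP[].
have gg0 x : 0 <= (g \_ U) x.
  by rewrite patchE; case: ifPn => // /set_mem; exact: g0.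
rewrite !ge0_integralTE//; apply: ereal_sup_le => _ [s /= sf <-].
exists s => // x; apply: (le_trans (sf x)); rewrite !patchE.
case: ifPn => [/set_mem Dx|_]; last by case: ifPn => // /set_mem; exact: g0.
by rewrite mem_set; [have /andP[] := fg _ Dx|exact: DU].
Qed.

(** A set of measure at most [L] leaves a [k]-mass of order [L ^ (- th)] as seen
from its points in [S].  The mass is witnessed by a set [A] on which [k] is at
least a constant [c], rather than by an integral, so that [k] may be arbitrary.
The point [y] belongs to [E], hence not to [A]: this leaves room for kernels that
take the conventional value zero on the diagonal. *)
Definition isoperimetric_kernel (k : T -> T -> R) (S U : set T) (th kap : R) :=
  forall (y : T) (E : set T) (L : R), S y -> measurable E -> E y -> (0 < L)%R ->
    mu E <= L%:E -> mu (E `\` S) = 0 ->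
  exists (A : set T) (c : R), [/\ measurable A, A `<=` U `\` E, (0 <= c)%R,
    (forall x, A x -> (c <= k x y)%R) & (kap * L `^ (- th))%:E <= c%:E * mu A].

Lemma measurable_neq0 (f : T -> R) : measurable_fun setT f ->
  measurable [set x | f x != 0%R].
Proof.
move=> mf; rewrite (_ : [set x | _] = f @^-1` (~` [set 0%R])); last first.
  by apply/seteqP; split => x /= /eqP.
by rewrite -[X in measurable X]setTI; apply: mf => //; exact: measurableC.
Qed.

Lemma dist_min_norm_le (a b N : R) : (`|Num.min `|a| N - Num.min `|b| N| <= `|a - b|)%R.
Proof.
apply: (le_trans _ (ler_dist_dist a b)).
move: `|a|%R `|b|%R => x y; rewrite /Num.min.
case: ltP => h1; case: ltP => h2 //.
- rewrite ler0_norm; last lra.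
  rewrite ler0_norm; lra.
- rewrite ger0_norm; last lra.
  rewrite ger0_norm; lra.
- by rewrite subrr normr0.
Qed.

Variables (k : T -> T -> R) (S U : set T) (q th kap : R).
Hypotheses (k_ge0 : forall x y, (0 <= k x y)%R) (mS : measurable S)
  (SU : S `<=` U) (q_gt0 : (0 < q)%R) (th_gt0 : (0 < th)%R) (th_lt1 : (th < 1)%R)
  (kap_gt0 : (0 < kap)%R) (kP : isoperimetric_kernel k S U th kap).

Let qs : R := (q / (1 - th))%R.

Let qs_gt0 : (0 < qs)%R. Proof. by rewrite divr_gt0// subr_gt0. Qed.

(* The self-reproducing exponent: the power of the level produced by one
   application of the isoperimetric property is again qs. *)
Let qsE : (q + qs * th = qs)%R.
Proof.
have th1 : (1 - th)%R != 0%R by rewrite subr_eq0 gt_eqF.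
by rewrite /qs; field.
Qed.

Section bounded.
Variables (u : T -> R) (I : R).
Hypotheses (u_ge0 : forall x, (0 <= u x)%R) (mu_ : measurable_fun setT u)
  (uS : mu ([set x | u x != 0%R] `\` S) = 0) (I_gt0 : (0 < I)%R)
  (uI : \int[mu]_(x in S) (u x `^ qs)%:E = I%:E).

Let measurable_superlevel (l : R) : measurable [set x | (l < u x)%R].
Proof.
rewrite (_ : [set x | _] = u @^-1` `]l, +oo[%classic); last first.
  by apply/seteqP; split => x /=; rewrite in_itv/= andbT.
by rewrite -[X in measurable X]setTI; exact: mu_.
Qed.

Lemma superlevel_null (l : R) : (0 < l)%R -> mu ([set x | (l < u x)%R] `\` S) = 0.
Proof.
move=> l0; apply/eqP; rewrite -measure_le0 -uS.
apply: le_measure; rewrite ?inE.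
- exact: measurableD.
- exact/measurableD/mS/measurable_neq0.
- by move=> x /= [lu Sx]; split=> //; rewrite gt_eqF// (lt_trans l0).
Qed.

(** Chebyshev's inequality on [S]; outside [S] the superlevel set is null. *)
Lemma superlevel_le (l : R) : (0 < l)%R ->
  mu [set x | (l < u x)%R] <= (l `^ (- qs) * I)%:E.
Proof.
move=> l0; rewrite (measureDI mu (measurable_superlevel l) mS).
rewrite [X in X + _](_ : _ = 0) ?add0e; last exact: superlevel_null.
have lq0 : (0 < l `^ qs)%R by rewrite powR_gt0.
have : (l `^ qs)%:E * mu ([set x | (l < u x)%R] `&` S) <= I%:E.
  rewrite -integral_cst//; last exact: measurableI.
  rewrite -uI; apply: ge0_le_integral_subset => [x []//|x [/= lu _]|x _].
    rewrite !lee_fin powR_ge0/= ge0_ler_powR// ?nnegrE//; exact: ltW.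
  by rewrite lee_fin powR_ge0.
rewrite powRN muleC -lee_pdivlMr//.
by rewrite muleC -EFinM.
Qed.

(** The heart of the argument: the isoperimetric property applied to the
superlevel set of [u] at half the value [u y]. *)
Lemma inner_integral_ge (y : T) : S y -> (0 < u y)%R ->
  (kap * (2^-1 `^ qs) * I `^ (- th) * u y `^ qs)%:E <=
  \int[mu]_(x in U) (`|u x - u y| `^ q * k x y)%:E.
Proof.
move=> Sy uy; pose l := (u y / 2)%R.
have l0 : (0 < l)%R by rewrite divr_gt0.
have Ey : (l < u y)%R by rewrite /l; lra.
have L0 : (0 < l `^ (- qs) * I)%R by rewrite mulr_gt0// powR_gt0.
have [A [c [mA AU c0 cA kapA]]] :=
  kP Sy (measurable_superlevel l) Ey L0 (superlevel_le l0) (superlevel_null l0).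
have -> : (kap * (2^-1 `^ qs) * I `^ (- th) * u y `^ qs =
    l `^ q * (kap * (l `^ (- qs) * I) `^ (- th)))%R.
  rewrite powRM ?powR_ge0 ?ltW// -powRrM mulrNN.
  have -> : (l `^ q * (kap * (l `^ (qs * th) * I `^ (- th))) =
     kap * (l `^ q * l `^ (qs * th)) * I `^ (- th))%R by ring.
  rewrite -powRD; last by rewrite qsE gt_eqF.
  rewrite qsE /l powRM ?ltW ?invr_gt0//; ring.
rewrite EFinM; apply: (@le_trans _ _ ((l `^ q)%:E * (c%:E * mu A))).
  by rewrite lee_wpmul2l// lee_fin powR_ge0.
rewrite muleA -EFinM -integral_cst//.
apply: ge0_le_integral_subset => [x /AU[]//|x Ax|x _]; last first.
  by rewrite lee_fin mulr_ge0// powR_ge0.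
have [Ux /= /negP] := AU _ Ax; rewrite -leNgt => ul.
rewrite !lee_fin mulr_ge0 ?powR_ge0//=; apply: ler_pM; rewrite ?powR_ge0//.
  apply: ge0_ler_powR; rewrite ?nnegrE ?(ltW q_gt0)//; first exact: ltW.
  rewrite distrC ler_normr; apply/orP; left.
  by move: ul; rewrite /l; lra.
exact: cA.
Qed.

Lemma energy_ge_norm : (kap * (2^-1 `^ qs) * I `^ (1 - th))%:E <=
  \int[mu]_(y in U) \int[mu]_(x in U) (`|u x - u y| `^ q * k x y)%:E.
Proof.
have -> : (kap * (2^-1 `^ qs) * I `^ (1 - th))%:E =
    (kap * (2^-1 `^ qs) * I `^ (- th))%:E * \int[mu]_(x in S) (u x `^ qs)%:E.
  rewrite uI -EFinM powRD; last by rewrite (gt_eqF I_gt0) implybT.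
  by rewrite powRr1 ?ltW//; congr (_%:E); ring.
have C0 : (0 <= kap * (2^-1 `^ qs) * I `^ (- th))%R.
  by rewrite !mulr_ge0 ?powR_ge0 ?ltW.
have mqs : measurable_fun S (fun x => (u x `^ qs)%:E).
  apply/measurable_EFinP; apply: (measurableT_comp (measurable_powR _)).
  exact: measurable_funTS.
rewrite -ge0_integralZl//; last by move=> x _; rewrite lee_fin powR_ge0.
apply: ge0_le_integral_subset => // y Sy; last first.
  by apply: integral_ge0 => x _; rewrite lee_fin mulr_ge0// powR_ge0.
rewrite -EFinM lee_fin mulr_ge0 ?powR_ge0//=.
have := u_ge0 y; rewrite le_eqVlt => /predU1P[uy0|uy0].
  rewrite -uy0 powR0 ?gt_eqF// mulr0.
  by apply: integral_ge0 => x _; rewrite lee_fin mulr_ge0// powR_ge0.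
exact: inner_integral_ge.
Qed.
End bounded.

(** Truncation reduces to a finite [qs]-norm: [min |f| N ^ qs] is at most
[N ^ (qs - q) |f| ^ q], whose integral is finite, and truncating is
1-Lipschitz. *)
Lemma nonlocal_sobolev (f : T -> R) : measurable_fun setT f ->
  mu ([set x | f x != 0%R] `\` S) = 0 ->
  \int[mu]_(x in S) (`|f x| `^ q)%:E < +oo ->
  (\int[mu]_(x in S) (`|f x| `^ qs)%:E) `^ (1 - th) <=
  ((kap * 2^-1 `^ qs)^-1)%:E *
  \int[mu]_(y in U) \int[mu]_(x in U) (`|f x - f y| `^ q * k x y)%:E.
Proof.
move=> mf fS fq.
set C := (kap * 2^-1 `^ qs)%R; have C0 : (0 < C)%R by rewrite mulr_gt0 ?powR_gt0.
set G := \int[mu]_(y in U) _.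
have G0 : 0 <= G.
  apply: integral_ge0 => y _; apply: integral_ge0 => x _.
  by rewrite lee_fin mulr_ge0// powR_ge0.
have th1 : (0 < 1 - th)%R by rewrite subr_gt0.
have p0 : (0 <= (1 - th)^-1)%R by rewrite invr_ge0 ltW.
pose u (N : nat) (x : T) : R := Num.min `|f x|%R N%:R.
have u0 N x : (0 <= u N x)%R by rewrite /u le_min normr_ge0 ler0n.
have mN N : measurable_fun setT (u N).
  apply: measurable_minr => //; exact: measurableT_comp.
have mqs N : measurable_fun S (fun x => (u N x `^ qs)%:E).
  apply/measurable_EFinP; apply: (measurableT_comp (measurable_powR _)).
  exact: measurable_funTS.
have uqs0 N x : 0 <= (u N x `^ qs)%:E by rewrite lee_fin powR_ge0.
have mfqs (p : R) : measurable_fun S (fun x => (`|f x| `^ p)%:E).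
  apply/measurable_EFinP; apply: (measurableT_comp (measurable_powR _)).
  by apply: measurable_funTS; exact: measurableT_comp.
have CG0 : 0 <= (C^-1)%:E * G by rewrite mule_ge0// lee_fin invr_ge0 ltW.
have ufin N : \int[mu]_(x in S) (u N x `^ qs)%:E < +oo.
  apply: (@le_lt_trans _ _
      ((N%:R `^ (qs * th))%:E * \int[mu]_(x in S) (`|f x| `^ q)%:E)).
    rewrite -ge0_integralZl ?lee_fin ?powR_ge0//.
    apply: ge0_le_integral_subset => // x _.
    rewrite uqs0/= -EFinM lee_fin -{1}qsE addrC powRD; last first.
      by rewrite addrC qsE (gt_eqF qs_gt0).
    have qth : (0 <= qs * th)%R by rewrite ltW// mulr_gt0.
    by apply: ler_pM; rewrite ?powR_ge0// ge0_ler_powR ?nnegrE ?(ltW q_gt0)//;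
      rewrite ge_min lexx ?orbT.
  by rewrite lte_mul_pinfty// lee_fin powR_ge0.
have uG N : \int[mu]_(x in S) (u N x `^ qs)%:E <= ((C^-1)%:E * G) `^ (1 - th)^-1.
  have [I0|I0] := leP (\int[mu]_(x in S) (u N x `^ qs)%:E) 0.
    by apply: (le_trans I0); exact: poweR_ge0.
  have Ifin : \int[mu]_(x in S) (u N x `^ qs)%:E \is a fin_num.
    by rewrite ge0_fin_numE// ltW.
  have uS : mu ([set x | u N x != 0%R] `\` S) = 0.
    apply/eqP; rewrite -measure_le0 -fS; apply: le_measure; rewrite ?inE.
    - exact/measurableD/mS/(measurable_neq0 (mN N)).
    - exact/measurableD/mS/(measurable_neq0 mf).
    - move=> x /= [ux Sx]; split=> //; apply: contra ux => /eqP fx0.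
      by rewrite /u fx0 normr0 min_l.
  move: I0; have CG :=
    @energy_ge_norm (u N) (fine _) (u0 N) (mN N) uS _ (esym (fineK Ifin)).
  rewrite -(fineK Ifin) lte_fin; move: (fine _) CG => J CG J0.
  have {CG} JG : J%:E `^ (1 - th) <= (C^-1)%:E * G.
    have {}CG := CG J0.
    rewrite poweR_EFin (lee_pdivlMl _ _ C0) -EFinM.
    apply: (le_trans CG); apply: ge0_le_integral_subset => // y Uy; last first.
      by apply: integral_ge0 => x _; rewrite lee_fin mulr_ge0// powR_ge0.
    rewrite integral_ge0/=; last first.
      by move=> x _; rewrite lee_fin mulr_ge0// powR_ge0.
    apply: ge0_le_integral_subset => // x Ux; last first.
      by rewrite lee_fin mulr_ge0// powR_ge0.
    rewrite !lee_fin mulr_ge0 ?powR_ge0//= ler_wpM2r//.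
    rewrite ge0_ler_powR ?nnegrE ?(ltW q_gt0)//; exact: dist_min_norm_le.
  have -> : J%:E = (J%:E `^ (1 - th)) `^ (1 - th)^-1.
    by rewrite -poweRrM mulfV ?gt_eqF// poweRe1// lee_fin ltW.
  by apply: le_poweR => //; exact: poweR_ge0.
have -> : \int[mu]_(x in S) (`|f x| `^ qs)%:E =
   limn (fun N => \int[mu]_(x in S) (u N x `^ qs)%:E).
  rewrite -monotone_convergence//; last first.
    move=> x _ N M NM; rewrite lee_fin ge0_ler_powR ?nnegrE ?(ltW qs_gt0)//.
    by rewrite /u le_min !ge_min lexx/= ler_nat NM orbT.
  apply: eq_integral => x _ /=; apply/esym/lim_near_cst => //.
  near=> N; congr (_ `^ _)%:E; apply/min_idPl.
  by near: N; exact: nbhs_infty_ger.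
have -> : (C^-1)%:E * G = (((C^-1)%:E * G) `^ (1 - th)^-1) `^ (1 - th).
  by rewrite -poweRrM mulVf ?gt_eqF// poweRe1.
have und : {homo (fun N => \int[mu]_(x in S) (u N x `^ qs)%:E) :
    N M / (N <= M)%N >-> N <= M}.
  move=> N M NM; apply: ge0_le_integral_subset => // x _.
  rewrite uqs0/= lee_fin ge0_ler_powR ?nnegrE ?(ltW qs_gt0)//.
  by rewrite /u le_min !ge_min lexx/= ler_nat NM orbT.
have ucv := ereal_nondecreasing_is_cvgn und.
apply: le_poweR; first exact: ltW.
  by apply: lime_ge => //; apply: nearW => N; exact: integral_ge0.
by apply: lime_le => //; apply: nearW => N; exact: uG.
Unshelve. all: by end_near.
Qed.
End nonlocal_sobolev.

(** * Volumes of balls and of spherical shells *)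

(* The same name also denotes the extended distance of a pseudometric space. *)
Local Notation edist := (@Defs.edist _ _).

Section geometry.
Context (R : realType).

Lemma borel_measurable_Rn n (A : set (n.-tuple R)) :
  measurable A -> measurable (A : set (Rn R n)).
Proof. by move=> mA; apply: sub_caratheodory; exact: sub_sigma_algebra. Qed.

Lemma lebesgueE n (A : set (n.-tuple R)) : measurable A ->
  @lebesgue R n A = borel_lebesgue A.
Proof.
by move=> mA; rewrite /lebesgue /completed_measure_extension measurable_mu_extE.
Qed.

(** Open balls of the supremum norm: products of intervals, whose volume follows
by induction from the product structure of the measure. *)
Definition box n (z : n.-tuple R) (s : R) : set (n.-tuple R) :=
  [set y | forall i, `|tnth z i - tnth y i| < s].

Lemma tcons_box n (z0 : R) (z : n.-tuple R) (s : R) :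
  @tcons R n @^-1` box [tuple of z0 :: z] s = ball z0 s `*` box z s.
Proof.
apply/seteqP; split=> -[a w] /=.
  move=> zs; split; first by have := zs ord0; rewrite !tnth0.
  by move=> i; have := zs (lift ord0 i); rewrite !tnthS.
move=> [za zw] i; rewrite /box /=.
by case: (unliftP ord0 i) => [j ->|->]; rewrite ?tnthS ?tnth0.
Qed.

Lemma measurable_box n (z : n.-tuple R) (s : R) : measurable (box z s).
Proof.
rewrite (_ : box z s =
    \bigcap_(i in [set: 'I_n]) ((fun y => tnth y i) @^-1` ball (tnth z i) s)).
  apply: fin_bigcap_measurable; first exact: finite_finset.
  move=> i _; rewrite -[X in measurable X]setTI.
  by apply: measurable_tnth => //; exact: measurable_ball.
by apply/seteqP; split => y zy i => [_|]; [exact: zy|exact: (zy i)].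
Qed.

Lemma borel_lebesgue_box n (z : n.-tuple R) (s : R) : 0 < s ->
  borel_lebesgue (box z s) = ((2 * s) ^+ n)%:E.
Proof.
move=> s0; elim: n z => [z|n IH].
  rewrite /= diracE mem_set ?expr0//.
  by move=> [].
case/tupleP => z0 z; rewrite /= /pushforward tcons_box product_measure1E//; last first.
- exact: measurable_box.
- exact: measurable_ball.
rewrite [X in (_ * X)%E](IH z) [X in (X * _)%E](lebesgue_measure_ball z0 (ltW s0)).
by rewrite -EFinM exprS mulr_natl.
Qed.

Definition sqdist n (x y : n.-tuple R) : R := \sum_(i < n) (tnth x i - tnth y i) ^+ 2.

Lemma sqdist_ge0 n (x y : n.-tuple R) : 0 <= sqdist x y.
Proof. by apply: sumr_ge0 => i _; exact: sqr_ge0. Qed.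

Lemma sqdistC n (x y : n.-tuple R) : sqdist x y = sqdist y x.
Proof. by apply: eq_bigr => i _; rewrite -sqrrN opprB. Qed.

Lemma sqdist_cons n (a b : R) (x y : n.-tuple R) :
  sqdist [tuple of a :: x] [tuple of b :: y] = (a - b) ^+ 2 + sqdist x y.
Proof.
rewrite /sqdist big_ord_recl !tnth0; congr (_ + _).
by apply: eq_bigr => i _; rewrite !tnthS.
Qed.

Lemma edist_lt n (x y : Rn R n) (r : R) : 0 < r ->
  (edist x y < r) = (sqdist x y < r ^+ 2).
Proof.
move=> r0; rewrite -(@ltr_pXn2r _ 2)// ?nnegrE ?sqrtr_ge0 ?(ltW r0)//.
by rewrite sqr_sqrtr// sqdist_ge0.
Qed.

Lemma edistC n (x y : Rn R n) : edist x y = edist y x.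
Proof. by congr Num.sqrt; exact: sqdistC. Qed.

Lemma edist_gt0 n (x y : Rn R n) : x <> y -> 0 < edist x y.
Proof.
move=> xy; rewrite lt_def sqrtr_ge0 andbT; apply/eqP => /eqP.
rewrite sqrtr_eq0 => d0; apply: xy; apply: eq_from_tnth => i.
have /eqP : sqdist x y = 0 by apply/eqP; rewrite eq_le sqdist_ge0 andbT.
rewrite psumr_eq0 => [/allP/(_ i (mem_index_enum _))|j _]; last exact: sqr_ge0.
by rewrite /= sqrf_eq0 subr_eq0 => /eqP.
Qed.

Lemma sqdist_box n (x y : n.-tuple R) (s : R) : 0 < s ->
  box x s y -> sqdist x y <= n%:R * s ^+ 2.
Proof.
move=> s0 xy; rewrite mulr_natl -[X in _ *+ X](card_ord n) -sumr_const.
apply: ler_sum => i _; rewrite -real_normK ?num_real//.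
by rewrite lerXn2r ?nnegrE ?(ltW s0)//; exact/ltW/xy.
Qed.

Lemma sqdist_sub_box n (x y : n.-tuple R) (s : R) : 0 < s ->
  sqdist x y < s ^+ 2 -> box x s y.
Proof.
move=> s0 xy i; rewrite -(@ltr_pXn2r _ 2)// ?nnegrE ?(ltW s0)//.
rewrite real_normK ?num_real//; apply: le_lt_trans xy.
rewrite /sqdist (bigD1 i)//= lerDl.
by apply: sumr_ge0 => j _; exact: sqr_ge0.
Qed.

Lemma measurable_sqdist n (x : n.-tuple R) : measurable_fun setT (sqdist x).
Proof.
apply: measurable_sum => i; apply: measurable_funX.
by apply: measurable_funB => //; exact: measurable_tnth.
Qed.

Lemma measurable_sqdist_lt n (x : n.-tuple R) (c : R) :
  measurable [set y | sqdist x y < c].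
Proof.
rewrite (_ : [set y | _] = sqdist x @^-1` `]-oo, c[%classic); last first.
  by apply/seteqP; split => y /=; rewrite in_itv/=.
by rewrite -[X in measurable X]setTI; exact: measurable_sqdist.
Qed.

Lemma eballE n (x : Rn R n) (r : R) : 0 < r ->
  eball x r = [set y | sqdist x y < r ^+ 2].
Proof. by move=> r0; apply/seteqP; split => y; rewrite /eball /= edist_lt. Qed.

Lemma measurable_eball n (x : Rn R n) (r : R) : 0 < r -> measurable (eball x r).
Proof.
by move=> r0; rewrite eballE//; apply: borel_measurable_Rn; exact: measurable_sqdist_lt.
Qed.

Lemma lebesgue_eball_le n (x : Rn R n) (r : R) : 0 < r ->
  (lebesgue (eball x r) <= ((2 * r) ^+ n)%:E)%E.
Proof.
move=> r0; rewrite -(borel_lebesgue_box x r0) -lebesgueE; last exact: measurable_box.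
apply: le_measure; rewrite ?inE; first exact: measurable_eball.
  by apply: borel_measurable_Rn; exact: measurable_box.
by rewrite eballE// => y /sqdist_sub_box; exact.
Qed.

(** A ball of radius [r] contains the box of half-width [r / n]. *)
Lemma lebesgue_eball_ge n (x : Rn R n) (r : R) : (1 < n)%N -> 0 < r ->
  (((2 / n%:R * r) ^+ n)%:E <= lebesgue (eball x r))%E.
Proof.
move=> n1 r0; have n0 : 0 < n%:R :> R by rewrite ltr0n ltnW.
have rn0 : 0 < r / n%:R by rewrite divr_gt0.
have -> : 2 / n%:R * r = 2 * (r / n%:R) by rewrite mulrAC mulrA.
rewrite -(borel_lebesgue_box x rn0) -lebesgueE; last exact: measurable_box.
apply: le_measure; rewrite ?inE; last 2 first.
- exact: measurable_eball.
- rewrite eballE// => y /(sqdist_box rn0) /le_lt_trans; apply => /=.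
  rewrite exprMn mulrCA gtr_pMr ?exprn_gt0//.
  by rewrite expr2 mulrA mulfV ?gt_eqF// mul1r invf_lt1// ltr1n.
by apply: borel_measurable_Rn; exact: measurable_box.
Qed.

Lemma measurable_slice n (A : set (n.+1.-tuple R)) (w : n.-tuple R) :
  measurable A -> measurable [set a | A [tuple of a :: w]].
Proof.
move=> mA; have mP : measurable (@tcons R n @^-1` A).
  by rewrite -[X in measurable X]setTI; exact: measurable_tcons.
rewrite (_ : [set a | _] = ysection (@tcons R n @^-1` A) w).
  exact: measurable_ysection.
by apply/seteqP; split => a; rewrite /ysection/= ?inE.
Qed.

(** Cavalieri's principle along the first coordinate. *)
Lemma borel_lebesgue_slice n (A : set (n.+1.-tuple R)) : measurable A ->
  (borel_lebesgue A = \int[@borel_lebesgue R n]_w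
    lebesgue_measure [set a | A [tuple of a :: w]])%E.
Proof.
move=> mA; rewrite /= /pushforward.
have mP : measurable (@tcons R n @^-1` A).
  by rewrite -[X in measurable X]setTI; exact: measurable_tcons.
rewrite (@product_measure_unique _ _ _ _ _ _ _
  (lebesgue_measure \x^ @borel_lebesgue R n)%E)//; last first.
  by move=> A1 A2 mA1 mA2; exact: product_measure2E.
rewrite /product_measure2; apply: eq_integral => w _ /=.
by congr lebesgue_measure; apply/seteqP; split => a; rewrite /ysection/= ?inE.
Qed.

(** A line at squared distance [D < r ^ 2] from the centre meets the shell between
the spheres of radii [r] and [t r] in segments of length at least [(t - 1) r]:
the difference of the two half-chords is smallest for [D = 0]. *)
Lemma sqrt_gap (r t D : R) : 0 < r -> 1 < t -> 0 <= D < r ^+ 2 ->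
  (t - 1) * r <= Num.sqrt ((t * r) ^+ 2 - D) - Num.sqrt (r ^+ 2 - D).
Proof.
move=> r0 t1 /andP[D0 Dr].
have rtr' : r < t * r by rewrite ltr_pMl.
have rtr : r ^+ 2 <= (t * r) ^+ 2 by rewrite lerXn2r ?nnegrE//; lra.
set G := Num.sqrt _; set g := Num.sqrt _.
have G2 : G ^+ 2 = (t * r) ^+ 2 - D by rewrite sqr_sqrtr//; lra.
have g2 : g ^+ 2 = r ^+ 2 - D by rewrite sqr_sqrtr//; lra.
have G0 : 0 <= G by exact: sqrtr_ge0.
have g0 : 0 <= g by exact: sqrtr_ge0.
have Gtr : G <= t * r by rewrite -(@ler_pXn2r _ 2)// ?nnegrE; nra.
have gr : g <= r by rewrite -(@ler_pXn2r _ 2)// ?nnegrE; nra.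
have Gg0 : 0 < G + g.
  rewrite ltr_wpDr// lt_def G0 andbT; apply/eqP => G_0; move: G2; rewrite G_0; nra.
rewrite -(ler_pM2r Gg0) -subr_sqr G2 g2; nra.
Qed.

(** Slicing the shell by the lines parallel to the first axis that pass through
the box of half-width [r / n.+1] in the remaining coordinates; each of them meets
the shell in length at least [(t - 1) r], which makes the volume linear in
[t - 1]. *)
Lemma borel_lebesgue_shell n (x : n.+1.-tuple R) (r t : R) :
  0 < r -> 1 < t ->
  (((2 / n.+1%:R) ^+ n * (t - 1) * r ^+ n.+1)%:E <=
   borel_lebesgue ([set y | (sqdist x y < (t * r) ^+ 2)%R] `\`
                   [set y | (sqdist x y < r ^+ 2)%R]))%E.
Proof.
move=> r0 t1; case/tupleP : x => z0 z.
rewrite borel_lebesgue_slice; last by apply: measurableD; exact: measurable_sqdist_lt.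
have s0 : 0 < r / n.+1%:R by rewrite divr_gt0.
have tr0 : 0 <= (t - 1) * r by nra.
have -> : ((2 / n.+1%:R) ^+ n * (t - 1) * r ^+ n.+1)%:E =
    (\int[@borel_lebesgue R n]_(w in box z (r / n.+1%:R)) ((t - 1) * r)%:E)%E.
  rewrite integral_cst; last exact: measurable_box.
  rewrite [X in (_ * X)%E](borel_lebesgue_box z s0).
  by rewrite -EFinM !exprMn exprS; congr (_%:E); ring.
apply: ge0_le_integral_subset => // w wz.
rewrite lee_fin tr0/=.
have Dr : 0 <= sqdist z w < r ^+ 2.
  rewrite sqdist_ge0/=; apply: (le_lt_trans (sqdist_box s0 wz)).
  rewrite exprMn mulrCA gtr_pMr ?exprn_gt0//.
  rewrite exprVn -ltr_pdivlMr ?invr_gt0 ?exprn_gt0// div1r invrK expr2.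
  by rewrite (@lt_le_trans _ _ n.+1%:R) ?ltr_nat// ler_peMr// ler1n.
have gap := sqrt_gap r0 t1 Dr; have /andP[D0 Dr'] := Dr.
set g := Num.sqrt (r ^+ 2 - _) in gap; set G := Num.sqrt (_ - _) in gap.
have gG : g < G by nra.
have : (((t - 1) * r)%:E <= lebesgue_measure [set` `[z0 + g, z0 + G[%R])%E.
  rewrite lebesgue_measure_itv/= lte_fin ltrD2l gG -EFinB lee_fin.
  by rewrite opprD addrACA subrr add0r.
move=> /le_trans; apply; apply: le_measure; rewrite ?inE.
- exact: measurable_itv.
- exact: (measurable_slice w (measurableD (measurable_sqdist_lt _ _)
    (measurable_sqdist_lt _ _))).
move=> a; rewrite /= in_itv/= => /andP[ga aG].
have g0 : 0 <= g by exact: sqrtr_ge0.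
rewrite sqdist_cons; split.
  rewrite -ltrBrDr -[ltRHS]sqr_sqrtr -/G; last by nra.
  nra.
apply/negP; rewrite -leNgt -lerBlDr -[leLHS]sqr_sqrtr -/g; last by nra.
nra.
Qed.

Lemma lebesgue_shell n (x : Rn R n) (r t : R) : (0 < n)%N -> 0 < r -> 1 < t ->
  (((2 / n%:R) ^+ n.-1 * (t - 1) * r ^+ n)%:E <=
   lebesgue (eball x (t * r) `\` eball x r))%E.
Proof.
case: n x => // n x _ r0 t1; have tr0 : 0 < t * r by nra.
rewrite !eballE// lebesgueE; first exact: borel_lebesgue_shell.
by apply: measurableD; exact: measurable_sqdist_lt.
Qed.

End geometry.

(** * The isoperimetric property of the Gagliardo kernel *)

Section kernel.
Context (R : realType) (n : nat).
Hypothesis n_gt1 : (1 < n)%N.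
Let mu := @lebesgue R n.

Let n_gt0 : 0 < n%:R :> R. Proof. by rewrite ltr0n ltnW. Qed.

Definition gagliardo_kernel (s : R) (x y : Rn R n) : R := (edist x y `^ (n%:R + s))^-1.

Lemma gagliardo_kernel_ge (s rho : R) (x y : Rn R n) : 0 < s -> x <> y ->
  edist x y <= rho -> (rho `^ (n%:R + s))^-1 <= gagliardo_kernel s x y.
Proof.
move=> s0 xy xyr; have d0 := edist_gt0 xy.
have rho0 := lt_le_trans d0 xyr.
rewrite lef_pV2 ?posrE ?powR_gt0//.
by rewrite ge0_ler_powR ?nnegrE ?addr_ge0 ?(ltW s0) ?(ltW d0) ?(ltW rho0)// ltW.
Qed.

(** The radius at which the lower bound [b rho ^ n] for the volume of a ball
equals [2 L], where [L] bounds the measure of the set to be avoided. *)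
Definition critical_radius (b L : R) : R := (2 * L / b) `^ n%:R^-1.

Lemma critical_radius_gt0 (b L : R) : 0 < b -> 0 < L -> 0 < critical_radius b L.
Proof. by move=> b0 L0; rewrite powR_gt0// divr_gt0// mulr_gt0. Qed.

Lemma critical_radiusX (b L : R) : 0 < b -> 0 < L ->
  b * critical_radius b L ^+ n = 2 * L.
Proof.
move=> b0 L0; have bL0 : 0 <= 2 * L / b by rewrite divr_ge0 ?mulr_ge0 ?ltW.
rewrite -powR_mulrn ?powR_ge0// -powRrM mulVf ?gt_eqF// powRr1//.
by rewrite mulrC divfK// gt_eqF.
Qed.

Lemma critical_radius_powRN (b L s : R) : 0 < b -> 0 < L ->
  critical_radius b L `^ (- s) = (2 / b) `^ (- (s / n%:R)) * L `^ (- (s / n%:R)).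
Proof.
move=> b0 L0; rewrite -powRM ?ltW ?divr_gt0// -powRrM; congr (_ `^ _); ring.
Qed.

Lemma measure_setD_ge d (T : measurableType d) (m : {measure set T -> \bar R})
  (B E : set T) (L : R) : measurable B -> measurable E ->
  (m E <= L%:E)%E -> ((2 * L)%:E <= m B)%E -> (L%:E <= m (B `\` E))%E.
Proof.
move=> mB mE EL LB; rewrite -(leeD2rE _ _ (_ : L%:E \is a fin_num))//.
rewrite -EFinD -mulr2n -mulr_natl; apply: (le_trans LB).
rewrite (measureDI m mB mE) leeD2l//; apply: le_trans EL.
by apply: le_measure; rewrite ?inE//; exact: measurableI.
Qed.

(** If a region [B] within the critical radius of [y] has volume at least [2 L],
then [B] minus [E] has volume at least [L], and there the kernel is at least its
value at the critical radius; the product is a multiple of [L ^ (- s / n)]. *)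
Lemma gagliardo_kernel_dense (s b L : R) (y : Rn R n) (E B : set (Rn R n)) :
  0 < s -> 0 < b -> 0 < L -> measurable E -> measurable B -> E y ->
  (mu E <= L%:E)%E -> ((b * critical_radius b L ^+ n)%:E <= mu B)%E ->
  (forall x, B x -> edist x y <= critical_radius b L) ->
  exists (A : set (Rn R n)) (c : R), [/\ measurable A, A `<=` B `\` E, 0 <= c,
    (forall x, A x -> c <= gagliardo_kernel s x y) &
    ((b / 2 * (2 / b) `^ (- (s / n%:R)) * L `^ (- (s / n%:R)))%:E <= c%:E * mu A)%E].
Proof.
move=> s0 b0 L0 mE mB Ey EL LB By.
have rX := critical_radiusX b0 L0.
have r0 := critical_radius_gt0 b0 L0.
have rN := critical_radius_powRN s b0 L0.
move: (critical_radius b L) LB By rX r0 rN => rho LB By rX r0 rN.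
exists (B `\` E), (rho `^ (n%:R + s))^-1; split => //.
- exact: measurableD.
- by rewrite invr_ge0 powR_ge0.
- move=> x [Bx Ex]; apply: gagliardo_kernel_ge => //; last exact: By.
  by move=> xy; apply: Ex; rewrite xy.
rewrite rX in LB; have LA := measure_setD_ge mB mE EL LB.
apply: (@le_trans _ _ ((rho `^ (n%:R + s))^-1%:E * L%:E)%E); last first.
  by apply: lee_wpmul2l => //; rewrite lee_fin invr_ge0 powR_ge0.
rewrite -EFinM lee_fin -mulrA -rN powRD; last by rewrite (gt_eqF r0) implybT.
rewrite powR_mulrn ?(ltW r0)// powRN invfM le_eqVlt; apply/orP; left; apply/eqP.
have -> : L = b * rho ^+ n / 2 by rewrite rX mulrC mulKf.
rewrite mulrA mulrAC; field.
by rewrite !gt_eqF ?powR_gt0// exprn_gt0.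
Qed.

Lemma ball_dense : exists2 b : R, 0 < b & forall (y : Rn R n) (rho : R), 0 < rho ->
  ((b * rho ^+ n)%:E <= mu (eball y rho))%E.
Proof.
exists ((2 / n%:R) ^+ n); first by rewrite exprn_gt0// divr_gt0.
by move=> y rho r0; rewrite -exprMn; exact: lebesgue_eball_ge.
Qed.

Lemma gagliardo_kernel_isoperimetric_space (s b : R) : 0 < s -> 0 < b ->
  (forall (y : Rn R n) (rho : R), 0 < rho ->
    ((b * rho ^+ n)%:E <= mu (eball y rho))%E) ->
  isoperimetric_kernel mu (gagliardo_kernel s) setT setT (s / n%:R)
    (b / 2 * (2 / b) `^ (- (s / n%:R))).
Proof.
move=> s0 b0 bP y E L _ mE Ey L0 EL _.
have r0 := critical_radius_gt0 b0 L0.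
have [||A [c [mA AE c0 cA cL]]] := gagliardo_kernel_dense s0 b0 L0 mE
  (measurable_eball y r0) Ey EL.
- exact: bP.
- by move=> x; rewrite /eball/= edistC => /ltW.
by exists A, c; split => // x /AE[].
Qed.

(** The image of [x0] under the homothety of centre [y] and ratio [s]. *)
Definition homothety (s : R) (x0 y : Rn R n) : Rn R n :=
  [tuple (1 - s) * tnth y i + s * tnth x0 i | i < n].

(** Interior density of balls.  The homothety of centre [y] and ratio [s] maps the
ball at [x0] onto the ball on the left; the image stays in the ball at [x0] by
convexity and lies within [2 s r] of [y].  Both facts reduce coordinatewise to
inequalities between squares. *)
Lemma homothetic_ball (x0 y : Rn R n) (r s : R) : 0 < r -> 0 < s <= 1 ->
  eball x0 r y ->
  eball (homothety s x0 y) (s * r) `<=` eball x0 r `&` eball y (2 * (s * r)).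
Proof.
move=> r0 /andP[s0 s1]; have sr0 : 0 < s * r by rewrite mulr_gt0.
rewrite !eballE ?mulr_gt0// => /= yr x /= xs.
have xs' : s^-2 * sqdist (homothety s x0 y) x < r ^+ 2.
  by rewrite mulrC ltr_pdivrMr ?exprn_gt0// -exprMn mulrC.
split.
  apply: (@le_lt_trans _ _ ((1 - s) * sqdist x0 y +
      s * (s^-2 * sqdist (homothety s x0 y) x))); last nra.
  rewrite /sqdist !mulr_sumr -big_split/=; apply: ler_sum => i _.
  rewrite tnth_mktuple.
  set a := tnth x0 i; set c := tnth y i; set e := tnth x i.
  pose v := ((1 - s) * c + s * a - e) / s.
  have -> : s^-2 * ((1 - s) * c + s * a - e) ^+ 2 = v ^+ 2.
    by rewrite /v expr_div_n mulrC.
  have -> : a - e = (1 - s) * (a - c) + s * v.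
    by rewrite /v mulrCA mulfV ?gt_eqF// mulr1; ring.
  move: (a - c) v => p w.
  have : 0 <= s * (1 - s) * (p - w) ^+ 2.
    by rewrite mulr_ge0 ?sqr_ge0// mulr_ge0 ?(ltW s0)// subr_ge0.
  lra.
apply: (@le_lt_trans _ _ (2 * s ^+ 2 * (sqdist x0 y +
    s^-2 * sqdist (homothety s x0 y) x))); last first.
  have -> : (2 * (s * r)) ^+ 2 = 2 * s ^+ 2 * (2 * r ^+ 2) by ring.
  by rewrite ltr_pM2l ?mulr_gt0 ?exprn_gt0//; lra.
rewrite /sqdist mulr_sumr -big_split/= mulr_sumr; apply: ler_sum => i _.
rewrite tnth_mktuple.
set a := tnth x0 i; set c := tnth y i; set e := tnth x i.
pose v := ((1 - s) * c + s * a - e) / s.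
have -> : s^-2 * ((1 - s) * c + s * a - e) ^+ 2 = v ^+ 2.
  by rewrite /v expr_div_n mulrC.
have -> : c - e = s * (v - (a - c)).
  by rewrite /v mulrBr mulrCA mulfV ?gt_eqF// mulr1; ring.
move: (a - c) v => p w.
have : 0 <= s ^+ 2 * (p + w) ^+ 2 by rewrite mulr_ge0 ?sqr_ge0.
lra.
Qed.

(** The constant 4 instead of 3 comes from using the inequality
[(a + b) ^ 2 <= 2 a ^ 2 + 2 b ^ 2] in place of the triangle inequality. *)
Lemma edist_le_radius (x0 x y : Rn R n) (r : R) : 0 < r ->
  eball x0 (2 * r) x -> eball x0 r y -> edist x y <= 4 * r.
Proof.
move=> r0; rewrite !eballE ?mulr_gt0// => /= xr yr.
apply: ltW; rewrite edist_lt ?mulr_gt0//.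
apply: (@le_lt_trans _ _ (2 * sqdist x0 x + 2 * sqdist x0 y)); last nra.
rewrite /sqdist !mulr_sumr -big_split/=; apply: ler_sum => i _.
move: (tnth x0 i) (tnth x i) (tnth y i) => a c e.
have := sqr_ge0 ((a - c) + (a - e)); lra.
Qed.

Lemma eball_subset (x0 : Rn R n) (r r' : R) : r <= r' -> eball x0 r `<=` eball x0 r'.
Proof. by move=> rr' x; rewrite /eball/= => /lt_le_trans; exact. Qed.

(** The factor [t - 1] is only lost when the critical radius exceeds [2 r], and
then the shell has to supply the mass. *)
Lemma gagliardo_kernel_isoperimetric_ball (s : R) : 0 < s ->
  exists2 K : R, 0 < K & forall (x0 : Rn R n) (r t : R), 0 < r -> 1 < t -> t <= 2 ->
  isoperimetric_kernel mu (gagliardo_kernel s) (eball x0 r) (eball x0 (t * r)) (s / n%:R)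
    (K * (t - 1)).
Proof.
move=> s0; have [b0 b00 b0P] := ball_dense.
(* Only a ball of half the critical radius is available inside the given ball,
   whence the factor 2 ^+ n; k is the contribution of the shell. *)
pose b := b0 / 2 ^+ n; have b_gt0 : 0 < b by rewrite divr_gt0// exprn_gt0.
pose k := (4 `^ (n%:R + s))^-1 * (2 / n%:R) ^+ n.-1.
have k0 : 0 < k.
  by rewrite mulr_gt0 ?invr_gt0 ?powR_gt0// exprn_gt0// divr_gt0.
pose K := Num.min (b / 2) k * (2 / b) `^ (- (s / n%:R)).
have K0 : 0 < K by rewrite mulr_gt0 ?powR_gt0 ?divr_gt0// lt_min k0 divr_gt0.
exists K => // x0 r t r0 t1 t2 y E L Sy mE Ey L0 EL ES.
have tr0 : 0 < t * r by nra.
have SU : eball x0 r `<=` eball x0 (t * r) by apply: eball_subset; nra.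
have rho0 := critical_radius_gt0 b_gt0 L0.
have [rho_le|rho_gt] := leP (critical_radius b L) (2 * r).
  pose a := critical_radius b L / (2 * r).
  have ar : a * r = critical_radius b L / 2.
    by rewrite /a invfM mulrA divfK// gt_eqF.
  have a01 : 0 < a <= 1.
    by rewrite /a divr_gt0 ?mulr_gt0//= ler_pdivrMr ?mulr_gt0// mul1r.
  have := homothetic_ball r0 a01 Sy; rewrite ar.
  have -> : 2 * (critical_radius b L / 2) = critical_radius b L by field.
  move=> BP.
  have [||A [c [mA AE c0 cA cL]]] := gagliardo_kernel_dense s0 b_gt0 L0 mE
    (measurable_eball (homothety a x0 y) (divr_gt0 rho0 (ltr0Sn R 1))) Ey EL.
  - apply: le_trans (b0P _ _ (divr_gt0 rho0 (ltr0Sn R 1))).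
    by rewrite lee_fin expr_div_n /b mulrAC mulrA.
  - by move=> x /BP[_]; rewrite /eball/= edistC => /ltW.
  exists A, c; split => //.
    by move=> x /AE[/BP[/SU]].
  apply: le_trans cL; rewrite lee_fin ler_wpM2r ?powR_ge0//.
  rewrite /K mulrAC ler_wpM2r ?powR_ge0//.
  apply: (@le_trans _ _ (Num.min (b / 2) k)); last by rewrite ge_min lexx.
  by rewrite ler_piMr; [|rewrite le_min !ltW// divr_gt0|lra].
(* Here L is at least of order r ^+ n, so the kernel at distance 4 * r times the
   volume of the shell suffices. *)
pose Sh := eball x0 (t * r) `\` eball x0 r.
have mSh : measurable Sh by apply: measurableD; exact: measurable_eball.
exists (Sh `\` E), ((4 * r) `^ (n%:R + s))^-1; split.
- exact: measurableD.
- by move=> x [[]].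
- by rewrite invr_ge0 powR_ge0.
- move=> x [[Ux _] Ex]; apply: gagliardo_kernel_ge => //.
    by move=> xy; apply: Ex; rewrite xy.
  apply: edist_le_radius Sy => //; apply: eball_subset Ux; nra.
have shL := lebesgue_shell x0 (ltnW n_gt1) r0 t1.
have muA : mu (Sh `\` E) = mu Sh.
  rewrite [RHS](measureDI mu mSh mE) [X in (_ + X)%E](_ : _ = 0%E) ?adde0//.
  apply/eqP; rewrite -measure_le0 -ES; apply: le_measure; rewrite ?inE.
  + exact: measurableI.
  + by apply: measurableD => //; exact: measurable_eball.
  + by move=> x [[_ Sx] Ex].
rewrite [X in (_ * X)%E]muA.
apply: (@le_trans _ _ (((4 * r) `^ (n%:R + s))^-1%:E *
  ((2 / n%:R) ^+ n.-1 * (t - 1) * r ^+ n)%:E)%E); last first.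
  by apply: lee_wpmul2l => //; rewrite lee_fin invr_ge0 powR_ge0.
rewrite -EFinM lee_fin.
have -> : ((4 * r) `^ (n%:R + s))^-1 * ((2 / n%:R) ^+ n.-1 * (t - 1) * r ^+ n) =
    k * (t - 1) * r `^ (- s).
  rewrite powRM ?(ltW r0)// (@powRD _ r n%:R s) ?(gt_eqF r0) ?implybT//.
  rewrite powR_mulrn ?(ltW r0)// powRN /k; field.
  by rewrite !gt_eqF ?powR_gt0// exprn_gt0.
apply: (@le_trans _ _ (k * (t - 1) * critical_radius b L `^ (- s))); last first.
  apply: ler_wpM2l; first by rewrite mulr_ge0 ?(ltW k0)//; lra.
  rewrite !powRN lef_pV2 ?posrE ?(powR_gt0 _ r0) ?(powR_gt0 _ rho0)//.
  by rewrite ge0_ler_powR ?nnegrE ?(ltW s0) ?(ltW r0) ?(ltW rho0)//; lra.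
rewrite (critical_radius_powRN s b_gt0 L0). rewrite /K.
have -> (x z p q : R) : x * z * p * q = x * p * (z * q) by ring.
rewrite ler_wpM2r ?mulr_ge0 ?powR_ge0//.
apply: ler_wpM2r; first lra.
by rewrite ge_min lexx orbT.
Qed.
End kernel.

(** * The fractional Sobolev inequality *)

Lemma sobolev_exponentE (R : realType) (n : nat) (h q : R) : (0 < n)%N ->
  sobolev_exponent n h q = q / (1 - h * q / n%:R).
Proof.
move=> n0; have n0' : n%:R != 0 :> R by rewrite pnatr_eq0 -lt0n.
have -> : 1 - h * q / n%:R = (n%:R - h * q) / n%:R by rewrite mulrBl divff.
by rewrite /sobolev_exponent invf_div mulrA (mulrC q).
Qed.

Lemma poweR_extract_root (R : realType) (q th C : R) (J G : \bar R) :
  0 < q -> th < 1 -> 0 < C -> (0 <= J)%E -> (0 <= G)%E ->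
  (J `^ (1 - th) <= C^-1%:E * G)%E ->
  (J `^ (q / (1 - th))^-1 <= (C `^ (- q^-1))%:E * G `^ q^-1)%E.
Proof.
move=> q0 th1 C0 J0 G0 JG.
have -> : (q / (1 - th))^-1 = (1 - th) / q by rewrite invf_div.
rewrite poweRrM; have q0' : 0 <= q^-1 by rewrite invr_ge0 ltW.
apply: (le_trans (le_poweR q0' (poweR_ge0 _ _) JG)).
rewrite poweRM ?lee_fin ?invr_ge0 ?(ltW C0)// poweR_EFin.
by rewrite -powR_inv1 ?(ltW C0)// -powRrM mulN1r.
Qed.

Lemma gagliardoE (R : realType) (n : nat) (h q : R) (U : set (Rn R n)) f :
  gagliardo h q U f = (\int[@lebesgue R n]_(y in U) \int[@lebesgue R n]_(x in U)
    (`|f x - f y| `^ q * gagliardo_kernel (h * q) x y)%:E)%E.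
Proof. by []. Qed.

Lemma gagliardo_ge0 (R : realType) (n : nat) (h q : R) (U : set (Rn R n)) f :
  (0 <= gagliardo h q U f)%E.
Proof.
apply: integral_ge0 => y _; apply: integral_ge0 => x _.
by rewrite lee_fin divr_ge0 ?powR_ge0.
Qed.

Section sobolev.
Context (R : realType) (n : nat) (h q : R).
Hypotheses (n_gt1 : (1 < n)%N) (hq_gt0 : 0 < h * q) (q_gt0 : 0 < q)
  (hq_lt : h * q < n%:R).
Let mu := @lebesgue R n.
Let qs := sobolev_exponent n h q.
Let th := h * q / n%:R.

Let n_gt0 : 0 < n%:R :> R. Proof. by rewrite ltr0n ltnW. Qed.
Let th_gt0 : 0 < th. Proof. by rewrite divr_gt0. Qed.
Let th_lt1 : th < 1. Proof. by rewrite ltr_pdivrMr// mul1r. Qed.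

Lemma fractional_sobolev_Lq (f : Rn R n -> R) (S : set (Rn R n)) :
  fractional_sobolev h q setT f -> (\int[mu]_(x in S) (`|f x| `^ q)%:E < +oo)%E.
Proof.
move=> [_]; apply: le_lt_trans.
apply: (@le_trans _ _ (\int[mu]_(x in setT) (`|f x| `^ q)%:E)%E).
  apply: ge0_le_integral_subset => // x _; rewrite lee_fin powR_ge0//=.
by rewrite leeDl// gagliardo_ge0.
Qed.

(** The common form of both inequalities, for a set [S] outside of which [f]
vanishes almost everywhere. *)
Lemma gagliardo_sobolev (S U : set (Rn R n)) (kap : R) (f : Rn R n -> R) :
  0 < kap -> measurable S -> S `<=` U ->
  isoperimetric_kernel mu (gagliardo_kernel (h * q)) S U th kap ->
  fractional_sobolev h q setT f -> mu ([set x | f x != 0] `\` S) = 0%E ->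
  ((\int[mu]_(x in S) (`|f x| `^ qs)%:E) `^ qs^-1 <=
   ((kap * 2^-1 `^ qs) `^ (- q^-1))%:E * gagliardo h q U f `^ q^-1)%E.
Proof.
move=> kap0 mS SU kP fW fS.
rewrite /qs sobolev_exponentE ?(ltnW n_gt1)//; apply: poweR_extract_root => //.
- by rewrite mulr_gt0// powR_gt0.
- by apply: integral_ge0 => x _; rewrite lee_fin powR_ge0.
- exact: gagliardo_ge0.
rewrite gagliardoE.
apply: nonlocal_sobolev => //.
- by move=> x y; rewrite invr_ge0 powR_ge0.
- exact: fW.1.
- exact: fractional_sobolev_Lq.
Qed.

Lemma ae_zero_outside (S : set (Rn R n)) (f : Rn R n -> R) :
  measurable S -> measurable_fun setT f ->
  {ae mu, forall x, (~` S) x -> f x = 0} -> mu ([set x | f x != 0] `\` S) = 0%E.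
Proof.
move=> mS mf fS; apply/negligibleP.
  exact: measurableD (measurable_neq0 mf) mS.
apply: negligibleS fS => x /= [/eqP fx Sx]; apply: contra_not fx; exact.
Qed.

(** The powers of [r] match because [n / qs = n / q - h]. *)
Lemma volume_scaling (b r v1 v2 : R) : 0 < b -> 0 < r -> b * r ^+ n <= v1 ->
  0 < v2 -> v2 <= (4 * r) ^+ n ->
  v1 `^ (- qs^-1) <= b `^ (- qs^-1) * 4 `^ (n%:R / q) * r `^ h * v2 `^ (- q^-1).
Proof.
move=> b0 r0 bv v20 v2r.
have brn0 : 0 < b * r ^+ n by rewrite mulr_gt0// exprn_gt0.
have qsV : qs^-1 = q^-1 - h / n%:R.
  rewrite /qs /sobolev_exponent invf_div; field.
  by rewrite !gt_eqF.
have qs0 : 0 <= qs^-1.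
  by rewrite invr_ge0 divr_ge0 ?mulr_ge0 ?(ltW q_gt0)// subr_ge0 ltW.
apply: (@le_trans _ _ ((b * r ^+ n) `^ (- qs^-1))).
  rewrite !powRN lef_pV2 ?posrE ?powR_gt0//; last exact: lt_le_trans bv.
  by rewrite ge0_ler_powR ?nnegrE// ltW// (lt_le_trans brn0).
apply: (@le_trans _ _ (b `^ (- qs^-1) * 4 `^ (n%:R / q) * r `^ h *
    ((4 * r) ^+ n) `^ (- q^-1))); last first.
  rewrite ler_wpM2l ?mulr_ge0 ?powR_ge0//.
  rewrite !powRN lef_pV2 ?posrE ?powR_gt0 ?exprn_gt0 ?mulr_gt0//.
  rewrite ge0_ler_powR ?nnegrE ?invr_ge0 ?(ltW q_gt0) ?(ltW v20)// ltW//.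
  by rewrite exprn_gt0// mulr_gt0.
rewrite -!powR_mulrn ?mulr_ge0 ?(ltW r0)//.
rewrite (powRM (- qs^-1)) ?powR_ge0 ?(ltW b0)// -!powRrM.
rewrite powRM ?(ltW r0)// (mulrN _ q^-1) !(powRN _ (n%:R / q)).
rewrite (_ : n%:R * - qs^-1 = h + - (n%:R / q)); last first.
  by rewrite qsV; field; rewrite !gt_eqF.
rewrite powRD ?(gt_eqF r0) ?implybT// (powRN r) le_eqVlt; apply/orP; left; apply/eqP.
by field; rewrite !gt_eqF// powR_gt0.
Qed.

Lemma normalized_sobolev (K b C v1 v2 r t : R) (J G : \bar R) :
  0 < K -> 0 < C -> 0 < b -> 0 < r -> 1 < t -> b * r ^+ n <= v1 ->
  0 < v2 -> v2 <= (4 * r) ^+ n -> (0 <= J)%E -> (0 <= G)%E ->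
  (J `^ qs^-1 <= ((K * (t - 1) * C) `^ (- q^-1))%:E * G `^ q^-1)%E ->
  (((v1%:E)^-1 * J) `^ qs^-1 <=
   (b `^ (- qs^-1) * 4 `^ (n%:R / q) * (K * C) `^ (- q^-1) *
     r `^ h / (t - 1) `^ q^-1)%:E * ((v2%:E)^-1 * G) `^ q^-1)%E.
Proof.
move=> K0 C0 b0 r0 t1 bv v20 v2r J0 G0 JG.
have v10 : 0 < v1 by apply: lt_le_trans bv; rewrite mulr_gt0// exprn_gt0.
have t10 : 0 < t - 1 by rewrite subr_gt0.
rewrite !inver !gt_eqF//.
rewrite !poweRM ?lee_fin ?invr_ge0 ?(ltW v10) ?(ltW v20)// !poweR_EFin.
have powRV (x y : R) : 0 < x -> x^-1 `^ y = x `^ (- y).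
  by move=> x0; rewrite -powR_inv1 ?(ltW x0)// -powRrM mulN1r.
rewrite !powRV// muleA -EFinM.
apply: (@le_trans _ _ ((v1 `^ (- qs^-1))%:E *
    (((K * (t - 1) * C) `^ (- q^-1))%:E * G `^ q^-1))%E).
  by rewrite lee_wpmul2l// lee_fin powR_ge0.
rewrite muleA -EFinM lee_wpmul2r ?poweR_ge0// lee_fin.
have -> : (K * (t - 1) * C) `^ (- q^-1) = (K * C) `^ (- q^-1) / (t - 1) `^ q^-1.
  have KC : 0 <= K * C by rewrite ltW// mulr_gt0.
  rewrite (_ : K * (t - 1) * C = K * C * (t - 1)); last by ring.
  by rewrite (powRM _ KC (ltW t10)) (powRN (t - 1)).
have := volume_scaling b0 r0 bv v20 v2r => /(ler_wpM2r
  (_ : 0 <= (K * C) `^ (- q^-1) / (t - 1) `^ q^-1)).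
have KC0 : 0 <= (K * C) `^ (- q^-1) / (t - 1) `^ q^-1.
  by rewrite divr_ge0 ?powR_ge0.
move=> /(_ KC0) /le_trans; apply.
by rewrite le_eqVlt; apply/orP; left; apply/eqP; ring.
Qed.

End sobolev.

Theorem lemma2p2 (R : realType) (n : nat) (h q : R)
    (n_ge2 : (2 <= n)%N) (h_gt0 : 0 < h) (h_lt1 : h < 1)
    (q_gt0 : 0 < q) (q_lt : q < n%:R / h) :
  let qs := sobolev_exponent n h q in
  let mu := @lebesgue R n in
  (exists c : R, 0 < c /\
    forall f : Rn R n -> R, fractional_sobolev h q setT f ->
      ((\int[mu]_x (`|f x| `^ qs)%:E) `^ qs^-1 <=
       c%:E * gagliardo h q setT f `^ q^-1)%E) /\
  (exists c : R, 0 < c /\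
    forall (f : Rn R n -> R) (x0 : Rn R n) (r t : R),
      fractional_sobolev h q setT f -> 0 < r ->
      {ae mu, forall x, (~` eball x0 r) x -> f x = 0} ->
      1 < t -> t <= 2 ->
      (((mu (eball x0 r))^-1 *
          \int[mu]_(x in eball x0 r) (`|f x| `^ qs)%:E) `^ qs^-1 <=
       (c * r `^ h / (t - 1) `^ q^-1)%:E *
         ((mu (eball x0 (t * r)))^-1 *
            gagliardo h q (eball x0 (t * r)) f) `^ q^-1)%E).
Proof.
move=> qs mu.
have hq_gt0 : 0 < h * q by rewrite mulr_gt0.
have hq_lt : h * q < n%:R by rewrite mulrC -ltr_pdivlMr.
have [b b0 bP] := ball_dense R n_ge2.
have C0 : 0 < 2^-1 `^ qs by rewrite powR_gt0.
split.
  have kapP := gagliardo_kernel_isoperimetric_space n_ge2 hq_gt0 b0 bP.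
  have kap0 : 0 < b / 2 * (2 / b) `^ (- (h * q / n%:R)).
    by rewrite mulr_gt0 ?powR_gt0 ?divr_gt0.
  exists ((b / 2 * (2 / b) `^ (- (h * q / n%:R)) * 2^-1 `^ qs) `^ (- q^-1)).
  split; first by rewrite powR_gt0// mulr_gt0.
  move=> f fW.
  apply: (gagliardo_sobolev n_ge2 hq_gt0 q_gt0 hq_lt kap0 _ _ kapP fW) => //.
  by rewrite setDT measure0.
have [K K0 KP] := gagliardo_kernel_isoperimetric_ball n_ge2 hq_gt0.
exists (b `^ (- qs^-1) * 4 `^ (n%:R / q) * (K * 2^-1 `^ qs) `^ (- q^-1)).
split; first by rewrite !mulr_gt0 ?powR_gt0 ?mulr_gt0.
move=> f x0 r t fW r0 f0 t1 t2.
have tr0 : 0 < t * r by rewrite mulr_gt0//; lra.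
have Kt0 : 0 < K * (t - 1) by rewrite mulr_gt0// subr_gt0.
have JG := gagliardo_sobolev n_ge2 hq_gt0 q_gt0 hq_lt Kt0
  (measurable_eball x0 r0) (@eball_subset _ _ x0 r (t * r) _)
  (KP x0 r t r0 t1 t2) fW
  (ae_zero_outside (measurable_eball x0 r0) fW.1 f0).
have finB rho : 0 < rho -> mu (eball x0 rho) \is a fin_num.
  move=> rho0; rewrite ge0_fin_numE//.
  exact: le_lt_trans (lebesgue_eball_le x0 rho0) (ltry _).
rewrite -(fineK (finB _ r0)) -(fineK (finB _ tr0)).
apply: normalized_sobolev => //.
- by rewrite -lee_fin fineK ?finB//; exact: bP.
- rewrite -lte_fin fineK ?finB//; apply: lt_le_trans (bP x0 _ tr0).
  by rewrite lte_fin mulr_gt0// exprn_gt0.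
- rewrite -lee_fin fineK ?finB//; apply: (le_trans (lebesgue_eball_le x0 tr0)).
  by rewrite lee_fin lerXn2r ?nnegrE; nra.
- by apply: integral_ge0 => x _; rewrite lee_fin powR_ge0.
- exact: gagliardo_ge0.
- apply: JG; nra.
Qed.
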